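(* Formulation F7 is strictly tighter than Formulation F5 (both defined in the context). Explicitly: (i) for every instance $(T,M,(W_m)_{m\in M})$ and every continuous solution $(X,S)$ of F7, the component $X$ is a continuous solution of F5; and (ii) there exist an instance and a continuous solution $X$ of F5 for that instance such that there is no $S$ for which $(X,S)$ is a continuous solution of F7.
   Context: An instance of the generator maintenance scheduling problem consists of a horizon $T=\{1,2,\dots,|T|\}$ of periods, a finite nonempty set $M$ of maintenances, and a positive integer duration $W_m$ for each $m\in M$. The variables are $X_{t,m}$ (maintenance $m$ is executed in period $t$) and $S_{t,m}$ (maintenance $m$ starts in period $t$), for $t\in T$, $m\in M$. Conventions: $X_{t,m}=0$ whenever $t\le 0$ or $t>|T|$; $S_{t,m}=0$ whenever $t\le 0$, $t>|T|$, or $t\ge |T|-W_m+2$ (a maintenance cannot start so late that it would not finish within the horizon). In particular every solution involving $S$ is required to satisfy $S_{t,m}=0$ for $t\in T$ with $t\ge |T|-W_m+2$. Formulation F5 (variables $X$ only): $\sum_{t\in T}X_{t,m}=W_m$ for all $m\in M$; $W_m\,(X_{t,m}-X_{t-1,m})\le \sum_{t'=t}^{t+W_m-1}X_{t',m}$ for all $t\in T$, $m\in M$; $X_{t,m}\in\{0,1\}$ for all $t\in T$, $m\in M$. Formulation F7 (variables $X,S$): $\sum_{t\in T}S_{t,m}=1$ for all $m\in M$; $\sum_{t'=t-W_m+1}^{t}S_{t',m}=X_{t,m}$ for all $t\in T$, $m\in M$; $X_{t,m},S_{t,m}\in\{0,1\}$ for all $t\in T$, $m\in M$. A continuous solution of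 a formulation is a real assignment of its variables satisfying its linear relaxation, i.e. all its constraints with each condition ''$\in\{0,1\}$'' replaced by ''$\in[0,1]$''. A formulation A is at least as tight as B if all continuous solutions satisfying A also satisfy B; A is strictly tighter than B if A is at least as tight as B and there is at least one continuous solution satisfying B that does not satisfy A. Since F5 has only the variables $X$, the comparison is in terms of $X$: a given $X$ satisfies F7 when some $S$ completes it to a continuous solution of F7. *)

(* Defs.v *)
(* MathComp, with the real numbers given by an arbitrary realType. *)
From mathcomp Require Import all_boot all_order all_algebra.
From mathcomp Require Import reals.
Set Implicit Arguments.
Unset Strict Implicit.
Unset Printing Implicit Defensive.
Import Order.TTheory GRing.Theory Num.Theory.
Local Open Scope ring_scope.

Record instance := Instance {
  horizon : nat;
  maint : finType;
  dur : maint -> nat;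
  maint_nonempty : (0 < #|maint|)%N;
  dur_gt0 : forall m, (0 < dur m)%N }.

(* The index i : 'I_(horizon I) stands for the period i + 1 of {1, ..., |T|}. *)
Definition period (n : nat) (i : 'I_n) : int := i.+1%:Z.

Section Formulations.
Variable R : realType.

Definition assignment (I : instance) := 'I_(horizon I) -> maint I -> R.

(* Extension of an assignment by 0 to the integers t <= 0 and t > |T|. *)
Definition at_period (I : instance) (X : assignment I) (t : int) (m : maint I) : R :=
  if t is Posz n.+1 then
    if @insub nat (fun k => (k < horizon I)%N) 'I_(horizon I) n is Some i
    then X i m else 0
  else 0.

(* A formulation is parametrised by the domain of its variables: {0, 1} for the
   integer program, [0, 1] for its linear relaxation. *)
Definition formulation := pred R -> forall I : instance, assignment I -> Prop.

Definition unit_interval : pred R := fun x => 0 <= x <= 1.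

Definition continuous_solution (A : formulation) (I : instance) (X : assignment I) :=
  A unit_interval I X.

Definition F5 : formulation := fun dom I X =>
  [/\ forall m, \sum_i X i m = (dur m)%:R,
      forall (i : 'I_(horizon I)) m, let t := period i in
        (dur m)%:R * (at_period X t m - at_period X (t - 1) m)
          <= \sum_(k < dur m) at_period X (t + k%:Z) m
    & forall i m, dom (X i m)].

(* The condition on late starts is part of the conventions on S; in the second
   constraint, t' = t - W_m + 1 + k runs from t - W_m + 1 to t. *)
Definition F7 (dom : pred R) (I : instance) (X S : assignment I) : Prop :=
  [/\ forall (i : 'I_(horizon I)) m,
        (horizon I)%:Z - (dur m)%:Z + 2 <= period i -> S i m = 0,
      forall m, \sum_i S i m = 1,
      forall (i : 'I_(horizon I)) m, let t := period i in
        \sum_(k < dur m) at_period S (t - (dur m)%:Z + 1 + k%:Z) m = at_period X t m,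
      forall i m, dom (X i m)
    & forall i m, dom (S i m)].

Definition F7_in_X : formulation := fun dom I X =>
  exists S : assignment I, F7 dom X S.

Definition at_least_as_tight (A B : formulation) : Prop :=
  forall (I : instance) (X : assignment I),
    continuous_solution A X -> continuous_solution B X.

Definition strictly_tighter (A B : formulation) : Prop :=
  at_least_as_tight A B /\
  exists (I : instance) (X : assignment I),
    continuous_solution B X /\ ~ continuous_solution A X.

End Formulations.

(* Main.v *)
Require Import Defs.
From mathcomp Require Import all_boot all_order all_algebra.
From mathcomp Require Import reals.
From mathcomp Require Import zify lra.

(** Inclusion.  Extend [X] and [S] by zero to all integers.  Because every start
    leaves room for the whole maintenance, the defining relation of F7,
    [X_t = S_(t-W+1) + ... + S_t], then holds for every integer [t]
    ([at_period_execution]).  Both constraints of F5 follow from this convolution: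
    - summed over the horizon, it gives [W] shifted copies of the sum of [S], each
      equal to 1 because no mass of [S] is pushed out of the horizon by a shift of
      less than [W] ([sum_shifted_starts]);
    - consecutive values telescope to [X_t - X_(t-1) = S_t - S_(t-W) <= S_t], whereas
      [S_t] is one of the nonnegative terms of each of [X_t, ..., X_(t+W-1)], so that
      [W S_t] is at most their sum.

    Strictness.  With a horizon of 3 periods and one maintenance of duration 2, the
    only starts are in periods 1 and 2, and both make the maintenance occupy period 2;
    hence F7 forces [X_2 = 1].  The constant vector [(2/3, 2/3, 2/3)] nevertheless
    satisfies F5, whose second constraint only bounds upward jumps of [X]. *)

Set Implicit Arguments.
Unset Strict Implicit.
Unset Printing Implicit Defensive.
Import Order.TTheory GRing.Theory Num.Theory.
Local Open Scope ring_scope.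

(** * Extension by zero *)

Section Extension.
Variables (R : realType) (I : instance).
Implicit Types (X : assignment R I) (t : int) (m : maint I).

Lemma at_period_ord X (i : 'I_(horizon I)) m : at_period X (period i) m = X i m.
Proof. by rewrite /at_period /period /= valK. Qed.

Lemma at_period_le0 X t m : t <= 0 -> at_period X t m = 0.
Proof. by case: t => [[|n]|n]. Qed.

Lemma at_period_gt_horizon X t m : (horizon I)%:Z < t -> at_period X t m = 0.
Proof.
case: t => [[|n]|n] //= lt_hn.
by rewrite insubF //; apply/negbTE; rewrite -leqNgt; lia.
Qed.

Lemma in_horizonP t :
  1 <= t <= (horizon I)%:Z -> exists i : 'I_(horizon I), t = period i.
Proof.
case: t => [[|n]|n] //= n_le.
have lt_n : (n < horizon I)%N by lia.
by exists (Ordinal lt_n).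
Qed.

Lemma at_period_ge0 X t m : (forall i, 0 <= X i m) -> 0 <= at_period X t m.
Proof.
move=> X_ge0; have [t_le0|t_gt0] := lerP t 0; first by rewrite at_period_le0.
have [lt_ht|t_le] := ltrP (horizon I)%:Z t; first by rewrite at_period_gt_horizon.
have /in_horizonP[i ->] : 1 <= t <= (horizon I)%:Z by lia.
by rewrite at_period_ord.
Qed.

Lemma at_period_const (c : R) t m :
  at_period (fun _ _ => c) t m = if 1 <= t <= (horizon I)%:Z then c else 0.
Proof.
case: ifPn => [/in_horizonP[i ->]|]; first by rewrite at_period_ord.
have [t_le0 _|t_gt0 t_out] := lerP t 0; first by rewrite at_period_le0.
by rewrite at_period_gt_horizon //; lia.
Qed.

End Extension.

(** * F7 implies F5 *)

Section Inclusion.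
Variables (R : realType) (I : instance) (X S : assignment R I).
Hypothesis XS_F7 : F7 (@unit_interval R) X S.
Variable m : maint I.

Let T : int := (horizon I)%:Z.
Let W : int := (dur m)%:Z.
Let x t := at_period X t m.
Let s t := at_period S t m.

Lemma start_ge0 t : 0 <= s t.
Proof. by case: XS_F7 => _ _ _ _ S01; apply: at_period_ge0 => i; case/andP: (S01 i m). Qed.

Lemma start_late t : T - W + 2 <= t -> s t = 0.
Proof.
case: XS_F7 => late _ _ _ _ le_t.
have [t_le0|t_gt0] := lerP t 0; first exact: at_period_le0.
have [lt_Tt|t_le] := ltrP T t; first exact: at_period_gt_horizon.
have /in_horizonP[i eq_t] : 1 <= t <= T by lia.
by rewrite /s eq_t at_period_ord late // -eq_t.
Qed.

(** Outside the horizon the left-hand side is zero by convention, and so is every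
    term on the right: the starts involved are nonpositive, or late. *)
Lemma at_period_execution t : x t = \sum_(k < dur m) s (t - k%:Z).
Proof.
have [t_le0|t_gt0] := lerP t 0.
  by rewrite /x at_period_le0 // big1 // => k _; rewrite /s at_period_le0 //; lia.
have [lt_Tt|t_le] := ltrP T t.
  rewrite /x at_period_gt_horizon // big1 // => k _; apply: start_late.
  by have := ltn_ord k; rewrite /W; lia.
have /in_horizonP[i eq_t] : 1 <= t <= T by lia.
case: XS_F7 => _ _ XE _ _.
rewrite /x eq_t -[LHS](XE i m) (reindex_inj rev_ord_inj) /=.
apply: eq_bigr => k _; congr (at_period _ _ _).
by have := ltn_ord k; lia.
Qed.

(** A shift by one more period loses only [s (T - j)], a late start or an index
    before the horizon, and gains only a value at a nonpositive index. *)
Lemma sum_shifted_starts j :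
  (j < dur m)%N -> \sum_(i < horizon I) s (period i - j%:Z) = 1.
Proof.
elim: j => [_|j IHj lt_jW].
  case: XS_F7 => _ /(_ m) <- _ _ _; apply: eq_bigr => i _.
  by rewrite subr0 /s at_period_ord.
rewrite -(IHj (ltnW lt_jW)).
(* Both sides are the sum over [0, T] of [s (i - j)], without its last or its
   first term. *)
have first0 : s (0%:Z - j%:Z) = 0 by apply: at_period_le0; lia.
have last0 : s (T - j%:Z) = 0 by apply: start_late; rewrite /W; lia.
transitivity (\sum_(i < (horizon I).+1) s (i%:Z - j%:Z)).
  rewrite big_ord_recr /= last0 addr0; apply: eq_bigr => i _.
  by congr s; rewrite /period; lia.
by rewrite big_ord_recl /= first0 add0r; apply: eq_bigr => i _.
Qed.

Lemma sum_execution : \sum_i X i m = (dur m)%:R.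
Proof.
transitivity (\sum_(i < horizon I) \sum_(k < dur m) s (period i - k%:Z)).
  by apply: eq_bigr => i _; rewrite -at_period_execution /x at_period_ord.
rewrite exchange_big /= (eq_bigr (fun _ => 1)) => [|k _].
  by rewrite sumr_const card_ord.
exact: sum_shifted_starts.
Qed.

Lemma execution_increment t : x t - x (t - 1) = s t - s (t - W).
Proof.
suff : x t + s (t - W) = s t + x (t - 1) by lra.
rewrite !at_period_execution.
(* Both sides are [s t + ... + s (t - W)]. *)
transitivity (\sum_(k < (dur m).+1) s (t - k%:Z)); first by rewrite big_ord_recr.
rewrite big_ord_recl /= subr0; congr (_ + _); apply: eq_bigr => k _.
by congr s; rewrite /bump /=; lia.
Qed.

Lemma start_le_execution t (k : 'I_(dur m)) : s t <= x (t + k%:Z).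
Proof.
rewrite at_period_execution (bigD1 k) //= addrK lerDl.
by apply: sumr_ge0 => j _; apply: start_ge0.
Qed.

Lemma increment_le_window t :
  (dur m)%:R * (x t - x (t - 1)) <= \sum_(k < dur m) x (t + k%:Z).
Proof.
apply: (@le_trans _ _ (\sum_(k < dur m) s t)); last first.
  by apply: ler_sum => k _; apply: start_le_execution.
rewrite sumr_const card_ord -[leRHS]mulr_natl ler_wpM2l // execution_increment.
by rewrite gerBl start_ge0.
Qed.

End Inclusion.

Lemma F7_at_least_as_tight (R : realType) : at_least_as_tight (@F7_in_X R) (@F5 R).
Proof.
move=> I X [S XS_F7]; split=> [m|i m|].
- exact: sum_execution XS_F7 m.
- exact: increment_le_window XS_F7 m (period i).
- by case: XS_F7.
Qed.

(** * A solution of F5 outside F7 *)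

Lemma unit_nonempty : (0 < #|unit : finType|)%N.
Proof. by rewrite card_unit. Qed.

Definition three_periods : instance :=
  @Instance 3 unit (fun=> 2%N) unit_nonempty (fun=> isT).

Definition two_thirds (R : realType) : assignment R three_periods :=
  fun _ _ => 2%:R / 3%:R.

Lemma two_thirds_F5 (R : realType) : continuous_solution (@F5 R) (@two_thirds R).
Proof.
split=> [m|i m|i m].
- by rewrite /= !big_ord_recl big_ord0 /two_thirds; lra.
- cbv zeta; rewrite -[dur m]/2%N !big_ord_recl big_ord0 /two_thirds !at_period_const.
  by case: i => [[|[|[|n]]]] //= _; lra.
- by rewrite /unit_interval /= /two_thirds; lra.
Qed.

(** Period 3 is a late start, so the starts in periods 1 and 2 sum to 1; their sum is
    also [X_2]. *)
Lemma F7_three_periods_mid (R : realType) (X S : assignment R three_periods) :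
  F7 (@unit_interval R) X S -> X (inord 1) tt = 1.
Proof.
case=> late sumS XE _ _.
pose i1 : 'I_3 := ord0.
pose i2 : 'I_3 := lift ord0 ord0.
have -> : inord 1 = i2 by apply: val_inj; rewrite /= inordK.
rewrite -(at_period_ord X i2 tt) -[LHS](XE i2 tt).
have := sumS tt; rewrite /= !big_ord_recl !big_ord0 /=.
rewrite (late (lift _ (lift _ _)) tt) // !addr0 => <-.
congr (_ + _).
  exact: (at_period_ord S i1 tt).
exact: (at_period_ord S i2 tt).
Qed.

Theorem proposition3p5 (R : realType) : strictly_tighter (@F7_in_X R) (@F5 R).
Proof.
split; first exact: F7_at_least_as_tight.
exists three_periods, (@two_thirds R); split; first exact: two_thirds_F5.
by case=> S /F7_three_periods_mid; rewrite /two_thirds; lra.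
Qed.
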